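(* For any complete network $K_n=(V,E)$ on $n$ nodes, any threshold function $t:V\to\{1,2,\dots\}$ with $1\le t(v)\le n-1$ for all $v$, and any integer $\lambda\ge 1$, the TBI problem on $K_n$ with thresholds $t$ and time bound $\lambda$ can be solved (an optimal incentive function can be computed) in time $O(\lambda n\log n)$.
   Context: Influence model: a network is a graph $G=(V,E)$; $N(v)$ is the neighbourhood of $v$ and $d(v)=|N(v)|$. A threshold function $t:V\to\{1,2,\dots\}$ satisfies $1\le t(v)\le d(v)$ for all $v$. An incentive function is $p:V\to\{0,1,2,\dots\}$ with $0\le p(v)\le t(v)$; its cost is $\sum_{v\in V}p(v)$. The influence process starting from $p$ is: $\mathsf{Influenced}[p,0]=\{v: p(v)=t(v)\}$ and, for $\ell>0$, $\mathsf{Influenced}[p,\ell]=\mathsf{Influenced}[p,\ell-1]\cup\{v: |N(v)\cap \mathsf{Influenced}[p,\ell-1]|\ge t(v)-p(v)\}$. The TBI problem: given $G$, $t$ and a time bound $\lambda$, find an incentive function $p$ of minimum cost such that $\mathsf{Influenced}[p,\lambda]=V$. *)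

(* Defs.v *)
From mathcomp Require Import all_boot.
Set Implicit Arguments. Unset Strict Implicit. Unset Printing Implicit Defensive.

Section Influence.
Variable n : nat.
(* N v = neighbourhood of v *)
Variable N : 'I_n -> {set 'I_n}.

Fixpoint influenced (t p : 'I_n -> nat) (l : nat) : {set 'I_n} :=
  match l with
  | 0 => [set v | p v == t v]
  | l'.+1 => let S := influenced t p l' in
             S :|: [set v | t v - p v <= #|N v :&: S|]
  end.

Definition is_incentive (t p : 'I_n -> nat) : Prop := forall v, p v <= t v.

Definition incentive_cost (p : 'I_n -> nat) : nat := \sum_(v : 'I_n) p v.

Definition TBI_feasible (t : 'I_n -> nat) (lam : nat) (p : 'I_n -> nat) : Prop :=
  is_incentive t p /\ influenced t p lam = [set: 'I_n].

Definition TBI_optimal (t : 'I_n -> nat) (lam : nat) (p : 'I_n -> nat) : Prop :=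
  TBI_feasible t lam p /\
  forall q, TBI_feasible t lam q -> incentive_cost p <= incentive_cost q.
End Influence.

Definition complete_nbhd (n : nat) (v : 'I_n) : {set 'I_n} := [set u | u != v].

Definition memory := nat -> nat.

Inductive expr : Type :=
  | ENum  of nat
  | ELoad of expr
  | EAdd  of expr & expr
  | ESub  of expr & expr       (* truncated subtraction *)
  | EHalf of expr
  | ELt   of expr & expr
  | EEq   of expr & expr.

Fixpoint eval (m : memory) (e : expr) : nat :=
  match e with
  | ENum k => k
  | ELoad e1 => m (eval m e1)
  | EAdd e1 e2 => eval m e1 + eval m e2
  | ESub e1 e2 => eval m e1 - eval m e2
  | EHalf e1 => (eval m e1)./2
  | ELt e1 e2 => nat_of_bool (eval m e1 < eval m e2)
  | EEq e1 e2 => nat_of_bool (eval m e1 == eval m e2)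
  end.

Inductive cmd : Type :=
  | CSkip
  | CStore of expr & expr
  | CSeq   of cmd & cmd
  | CIf    of expr & cmd & cmd
  | CWhile of expr & cmd.

Definition upd (m : memory) (a v : nat) : memory := fun b => if b == a then v else m b.

Inductive exec : cmd -> memory -> nat -> memory -> Prop :=
  | ExSkip m : exec CSkip m 1 m
  | ExStore e1 e2 m : exec (CStore e1 e2) m 1 (upd m (eval m e1) (eval m e2))
  | ExSeq c1 c2 m k1 m1 k2 m2 :
      exec c1 m k1 m1 -> exec c2 m1 k2 m2 -> exec (CSeq c1 c2) m (k1 + k2) m2
  | ExIfT e c1 c2 m k m' :
      eval m e != 0 -> exec c1 m k m' -> exec (CIf e c1 c2) m k.+1 m'
  | ExIfF e c1 c2 m k m' :
      eval m e = 0 -> exec c2 m k m' -> exec (CIf e c1 c2) m k.+1 m'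
  | ExWhileF e c m :
      eval m e = 0 -> exec (CWhile e c) m 1 m
  | ExWhileT e c m k1 m1 k2 m2 :
      eval m e != 0 -> exec c m k1 m1 -> exec (CWhile e c) m1 k2 m2 ->
      exec (CWhile e c) m (k1 + k2).+1 m2.

(* Input encoding of a TBI instance on K_n:
   mem[0] = n, mem[1] = lam, mem[2+i] = t(i) for i < n, all other cells 0. *)
Definition tbi_input (n lam : nat) (t : 'I_n -> nat) : memory :=
  fun a => if a == 0 then n else if a == 1 then lam
           else nth 0 [seq t i | i <- enum 'I_n] (a - 2).

Definition tbi_output (n : nat) (m : memory) : 'I_n -> nat := fun v => m (2 + n + v).

(* Main.v *)
Require Import Defs.
From mathcomp Require Import all_boot.
From mathcomp Require Import zify.
Set Implicit Arguments. Unset Strict Implicit. Unset Printing Implicit Defensive.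

(* Let F k ([below k.+1]) be the number of nodes of threshold at most k.  A feasible
   incentive yields sizes s_0 <= ... <= s_lam = n of the successive influenced
   sets, and counting the pairs (v, k) such that v still misses its k-th unit of
   influence bounds its cost below by the sum over the rounds of
   W (s_{i-1}, s_i), where W (j, m) ([gap j m]) is the sum of (m - F k)^+ for j <= k < m and
   s_{-1} = 0.  Conversely every chain is realised at this cost by giving
   (t v - s_i)^+ to the nodes whose rank in the sorted order lies between s_i and
   s_{i+1}.  The best chain is found by dynamic programming over the rounds.
   Since W satisfies the Monge inequality, the argmin of a row is monotone in m:
   computing the columns at odd multiples of a stride that is halved repeatedly,
   and scanning only between the argmins of the two neighbours, costs O(n) per
   stride, hence O(n log n) per round.  W itself is read in constant time off
   prefix sums of F, products being differences of triangular numbers. *)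

(** * Chains of influenced sets *)

Section Combinatorics.
Variables (n : nat) (t : 'I_n -> nat).

Definition below k := \sum_(v < n) (t v < k).

Definition gap j m := \sum_(j <= k < m) (m - below k.+1).

Definition chain_cost l (s : nat -> nat) :=
  gap 0 (s 0) + \sum_(0 <= i < l) gap (s i) (s i.+1).

Lemma below_mono k k' : k <= k' -> below k <= below k'.
Proof.
move=> kk'; apply: leq_sum => v _.
by case: (ltnP (t v) k) => // tk; rewrite (leq_trans tk kk').
Qed.

Lemma gap_split j i m : j <= i <= m ->
  gap j m = \sum_(j <= k < i) (m - below k.+1) + gap i m.
Proof. by case/andP=> ji im; rewrite /gap (big_cat_nat ji im). Qed.

Lemma gap_eq0 j m : m <= below j.+1 -> gap j m = 0.
Proof.
move=> mj; rewrite /gap big_nat big1 // => k /andP[jk _].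
by apply/eqP; rewrite subn_eq0 (leq_trans mj) // below_mono.
Qed.

Lemma sum_sub_below j m : (forall k, k < j -> below k.+1 <= m) ->
  \sum_(0 <= k < j) (m - below k.+1) + \sum_(0 <= k < j) below k.+1 = m * j.
Proof.
move=> jm; rewrite -big_split /= -[j in RHS]subn0 mulnC -sum_nat_const_nat.
by apply: eq_big_nat => k /andP[_ kj]; rewrite subnK // jm.
Qed.

(** When [below j.+1 < m], no term of index below [j] is truncated, so the first [j] terms of
    [gap 0 m] sum to [m * j] minus a prefix sum. Otherwise [gap_eq0] applies; either way [gap j m]
    can be read in constant time. *)
Lemma gap_prefix j m : j <= m -> below j.+1 < m ->
  gap j m + m * j = gap 0 m + \sum_(0 <= k < j) below k.+1.
Proof.
move=> jm bm; rewrite (@gap_split 0 j m) // -(@sum_sub_below j m); last first.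
  by move=> k kj; rewrite (leq_trans _ (ltnW bm)) // below_mono //; lia.
lia.
Qed.

(** Here [k] is the first index at which the terms of [gap 0 m] vanish, or [m] if there is none;
    before [k] nothing is truncated. *)
Lemma gap_head k m : k <= m -> (forall k', k' < k -> below k'.+1 < m) ->
  (k < m -> m <= below k.+1) ->
  gap 0 m + \sum_(0 <= k' < k) below k'.+1 = m * k.
Proof.
move=> km lo hi; rewrite (@gap_split 0 k m) // -(@sum_sub_below k m); last first.
  by move=> k' /lo /ltnW.
suff -> : gap k m = 0 by lia.
have [/hi/gap_eq0 //|mk] := ltnP k m.
by rewrite /gap big_geq.
Qed.

(** The gaps from [j] and from [j'] differ by the terms between [j] and [j'], and these grow with
    the upper end. *)
Lemma gap_monge j j' m m' : j <= j' -> j' <= m -> m <= m' ->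
  gap j m + gap j' m' <= gap j m' + gap j' m.
Proof.
move=> jj' j'm mm'.
rewrite (@gap_split j j' m) ?(@gap_split j j' m') ?jj' ?j'm ?(leq_trans j'm) //.
suff: \sum_(j <= k < j') (m - below k.+1) <= \sum_(j <= k < j') (m' - below k.+1).
  by lia.
by apply: leq_sum => k _; rewrite leq_sub2r.
Qed.

(** * Optimal chains by dynamic programming *)

Definition best (e : nat -> nat) m x :=
  x <= m /\ forall j, j <= m -> e x + gap x m <= e j + gap j m.

(** By the Monge inequality, a smaller index that is no better than [x] at column [m1] is no better
    at any later column. *)
Lemma best_left e m1 m x j : best e m1 x -> m1 <= m -> j <= x ->
  e x + gap x m <= e j + gap j m.
Proof.
case=> xm1 H m1m jx; have := H j (leq_trans jx xm1).
have := gap_monge jx xm1 m1m; lia.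
Qed.

Lemma best_right e m2 m x j : best e m2 x -> m <= m2 -> x <= j -> j <= m ->
  e x + gap x m <= e j + gap j m.
Proof.
case=> xm1 H m1m jx jm; have := H j (leq_trans jm m1m).
have := gap_monge jx jm m1m; lia.
Qed.

(** [e l] is the cost row after [l] rounds, and [o l] records the argmins that lead from it to row
    [l.+1]. *)
Definition dp_row (e : nat -> nat -> nat) (o : nat -> nat -> nat) l :=
  forall m, m <= n -> best (e l) m (o l m) /\
    e l.+1 m = e l (o l m) + gap (o l m) m.

Lemma dp_lower e o lam s : (forall m, m <= n -> e 0 m = gap 0 m) ->
  (forall l, l < lam -> dp_row e o l) ->
  (forall l, l < lam -> s l <= s l.+1) -> s lam <= n ->
  e lam (s lam) <= chain_cost lam s.
Proof.
move=> e0; elim: lam => [|l IH] rows smono sn.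
  by rewrite /chain_cost big_geq // e0 // addn0.
have sl : s l <= s l.+1 by apply: smono.
have [[_ ob] ->] := rows l (ltnSn l) _ sn.
apply: (leq_trans (ob _ sl)).
rewrite /chain_cost big_nat_recr //= addnA leq_add2r IH //; last exact: leq_trans sn.
  by move=> i il; apply: rows; lia.
by move=> i il; apply: smono; lia.
Qed.

(** Following the argmins backwards turns every inequality behind [dp_lower] into an equality. *)
Lemma dp_attained e o lam s : (forall m, m <= n -> e 0 m = gap 0 m) ->
  (forall l, l < lam -> dp_row e o l) ->
  (forall l, l < lam -> s l = o l (s l.+1)) -> s lam <= n ->
  (forall l, l < lam -> s l <= s l.+1) /\ e lam (s lam) = chain_cost lam s.
Proof.
move=> e0; elim: lam => [|l IH] rows so sn.
  by rewrite /chain_cost big_geq // e0 // addn0.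
have [[osl ob] E] := rows l (ltnSn l) _ sn.
rewrite -so // in osl E.
have [sm Es] : (forall i, i < l -> s i <= s i.+1) /\ e l (s l) = chain_cost l s.
  by apply: IH (leq_trans osl sn) => i il; [apply: rows|apply: so]; lia.
split; last by rewrite /chain_cost big_nat_recr //= addnA E Es.
move=> i; rewrite ltnS leq_eqVlt => /predU1P[->//|]; exact: sm.
Qed.

(** * Splitting sums along a chain and by height *)

Lemma sum_chain (f : nat -> nat) l s : (forall i, i < l -> s i <= s i.+1) ->
  \sum_(0 <= k < s l) f k =
  \sum_(0 <= k < s 0) f k + \sum_(0 <= i < l) \sum_(s i <= k < s i.+1) f k.
Proof.
elim: l => [|l IH] sm; first by rewrite [X in _ = _ + X]big_geq // addn0.
rewrite big_nat_recr //= addnA -IH => [|i il]; last by apply: sm; lia.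
by rewrite -(big_cat_nat _ (sm l _)).
Qed.

Lemma chain_mono l s i j : (forall i, i < l -> s i <= s i.+1) ->
  i <= j -> j <= l -> s i <= s j.
Proof.
move=> sm; elim: j => [|j IH]; first by rewrite leqn0 => /eqP->.
rewrite leq_eqVlt => /predU1P[->//|ij] jl.
by apply: leq_trans (sm j jl); apply: IH; lia.
Qed.

Lemma sum_in_interval a b c : \sum_(0 <= k < c) (a <= k < b) = minn b c - a.
Proof.
elim: c => [|c IH]; first by rewrite big_geq //; lia.
by rewrite big_nat_recr //= IH; lia.
Qed.

(** The units of the sum are counted by their height [k]; the bound on [t] confines the heights to
    those below [n]. *)
Lemma sum_layers (sg : 'I_n -> nat) : (forall v, t v <= n) ->
  \sum_v (t v - sg v) = \sum_(0 <= k < n) #|[set v | sg v <= k < t v]|.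
Proof.
move=> tn.
under [RHS]eq_bigr do rewrite -sum1dep_card big_mkcond /=.
rewrite exchange_big /=; apply: eq_bigr => v _.
by rewrite -[in LHS](minn_idPl (tn v)) -sum_in_interval; apply: eq_bigr => k _; case: ifP.
Qed.

Lemma below_card k : below k.+1 = #|[set v | t v <= k]|.
Proof.
rewrite -sum1dep_card big_mkcond /=; apply: eq_bigr => v _.
by rewrite ltnS; case: leqP.
Qed.

(** * Every feasible incentive costs at least as much as some chain *)

Section LowerBound.
Variable q : 'I_n -> nat.
Let S := influenced (@complete_nbhd n) t q.

(** For a node influenced by round [l], this is the size of the influenced set just before the round
    in which it joined, zero for the initial nodes. It bounds the influence the node had received on
    joining. *)
Fixpoint support l v :=
  if l is l'.+1 then if v \in S l' then support l' v else #|S l'| else 0.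

Lemma influenced_mono i j : i <= j -> S i \subset S j.
Proof.
elim: j => [|j IH]; first by rewrite leqn0 => /eqP->.
rewrite leq_eqVlt => /predU1P[->//|ij].
by apply: subset_trans (IH ij) _; apply: subsetUl.
Qed.

Lemma support_stable i j v : v \in S i -> i <= j -> support j v = support i v.
Proof.
move=> vi; elim: j => [|j IH]; first by rewrite leqn0 => /eqP->.
rewrite leq_eqVlt => /predU1P[->//|ij] /=.
by rewrite (subsetP (@influenced_mono i j ij) _ vi) IH.
Qed.

Lemma support_le l v : support l.+1 v <= #|S l|.
Proof.
elim: l => [|l IH] /=; first by case: ifP.
by case: ifP => // _; apply: leq_trans IH _; rewrite subset_leq_card // influenced_mono.
Qed.

(** At its joining round a node has at most the whole current set as influencing neighbours; the
    incentive must supply the rest. *)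
Lemma incentive_ge_support l v : v \in S l -> t v - support l v <= q v.
Proof.
elim: l => [|l IH]; first by rewrite inE => /eqP->; rewrite leq_subr.
rewrite [support _ _]/=; have [vl _|vl] := boolP (v \in S l); first exact: IH.
rewrite /S /= inE (negPf vl) inE /= => H.
by rewrite leq_subCl; apply: leq_trans H _; apply/subset_leq_card/subsetIr.
Qed.

(** At most [below k.+1] nodes of [S i] have threshold at most [k]; all the others still miss the
    unit at height [k]. *)
Lemma support_layer l i k : i <= l -> (forall v, v \in S i -> support l v <= k) ->
  #|S i| - below k.+1 <= #|[set v | support l v <= k < t v]|.
Proof.
move=> il H; rewrite below_card leq_subLR -cardsUI.
apply: leq_trans (leq_addr _ _); apply/subset_leq_card/subsetP => v /H Hv.
by rewrite !inE Hv /=; case: leqP.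
Qed.

Lemma feasible_lower lam : (forall v, t v <= n) ->
  TBI_feasible (@complete_nbhd n) t lam q ->
  exists s, [/\ forall i, i < lam -> s i <= s i.+1, s lam = n
              & chain_cost lam s <= incentive_cost q].
Proof.
move=> tn [_ Slam]; have cardS : #|S lam| = n by rewrite /S Slam cardsT card_ord.
have Smono i : #|S i| <= #|S i.+1| by rewrite subset_leq_card // influenced_mono.
exists (fun i => #|S i|); split=> //.
apply: (@leq_trans (\sum_v (t v - support lam v))); last first.
  by apply: leq_sum => v _; apply: incentive_ge_support; rewrite /S Slam inE.
rewrite sum_layers //.
(* Writing [n] as the last set size lets the sum over heights split along the chain. *)
suff: chain_cost lam (fun i => #|S i|) <=
      \sum_(0 <= k < #|S lam|) #|[set v | support lam v <= k < t v]| by rewrite cardS.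
rewrite (@sum_chain _ lam (fun i => #|S i|)) //.
apply: leq_add; rewrite ?big_nat; last apply: leq_sum => i /andP[_ il].
  rewrite /gap big_nat; apply: leq_sum => k /andP[_ k0]; apply: support_layer => // v v0.
  by rewrite (@support_stable 0).
(* At heights from [#|S i|] on, every node of [S i.+1] has support at most the height. *)
rewrite /gap !big_nat; apply: leq_sum => k /andP[ik _]; apply: support_layer => // v vi.
by rewrite (@support_stable i.+1) //; apply: leq_trans ik; apply: support_le.
Qed.
End LowerBound.

(** * Ranks in the stable sort of the nodes by threshold *)

Definition rank (v : 'I_n) := below (t v) + \sum_(u < n) ((u < v) && (t u == t v)).

Lemma rank_lt_below v : rank v < below (t v).+1.
Proof.
rewrite /rank /below -big_split /= [X in X < _](bigD1 v) //= [X in _ < X](bigD1 v) //=.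
rewrite !ltnn ltnSn /= add0n add1n ltnS; apply: leq_sum => u _; lia.
Qed.

(** A threshold above [k] puts all [below k.+1] nodes of threshold at most [k] ahead of the node;
    the other direction is [rank_lt_below]. *)
Lemma rank_below v k : (rank v < below k.+1) = (t v <= k).
Proof.
apply/idP/idP => [|tk]; last by apply: leq_trans (rank_lt_below v) (below_mono _).
apply: contraLR; rewrite -!ltnNge ltnS => kt.
by apply: leq_trans (below_mono kt) (leq_addr _ _).
Qed.

Lemma rank_lt v : rank v < n.
Proof.
apply: leq_trans (rank_lt_below v) _.
rewrite -[X in _ <= X]card_ord -sum1_card; apply: leq_sum => u _.
by case: (_ < _).
Qed.

Lemma rank_inj : injective rank.
Proof.
have rank_neq (u v : 'I_n) : u < v -> rank u != rank v.
  move=> uv; have [tuv|tvu|tuv] := ltngtP (t u) (t v).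
  - rewrite neq_ltn (leq_trans (rank_lt_below u)) //.
    by apply: leq_trans (below_mono tuv) (leq_addr _ _).
  - rewrite neq_ltn (leq_trans (rank_lt_below v)) ?orbT //.
    by apply: leq_trans (below_mono tvu) (leq_addr _ _).
  rewrite /rank tuv eqn_add2l neq_ltn; apply/orP; left.
  rewrite [X in X < _](bigD1 u) //= [X in _ < X](bigD1 u) //=.
  rewrite ltnn uv tuv eqxx /= add0n add1n ltnS; apply: leq_sum => w _; lia.
move=> u v uv; apply/val_inj/eqP; rewrite -[_ == _]negbK neq_ltn; apply/orP.
by case=> /rank_neq; rewrite uv eqxx.
Qed.

Lemma card_rank_lt k : k <= n -> #|[set v | rank v < k]| = k.
Proof.
(* An injection of ['I_n] into itself is a bijection, so every rank below [k] is taken. *)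
move=> kn; pose r v := Ordinal (rank_lt v).
have r_inj : injective r by move=> u v /(congr1 val)/rank_inj.
have -> : [set v | rank v < k] = r @^-1: [set i : 'I_n | i < k].
  by apply/setP => v; rewrite !inE.
rewrite on_card_preimset; last by apply/onW_bij/injF_bij.
transitivity (\sum_(i < n) (0 <= i < k)).
  by rewrite -sum1dep_card big_mkcond /=; apply: eq_bigr => i _; case: ifP.
by rewrite -(big_mkord xpredT (fun i => nat_of_bool (0 <= i < k))) sum_in_interval; lia.
Qed.

(** * Realising a chain by an incentive *)

Section UpperBound.
Variables (lam : nat) (s sg : nat -> nat).
Hypotheses (s_mono : forall i, i < lam -> s i <= s i.+1) (s_last : s lam = n).
Hypotheses (sg0 : forall r, r < s 0 -> sg r = 0)
  (sgS : forall i r, i < lam -> s i <= r < s i.+1 -> sg r = s i).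

(** [sg r] is the size the chain has reached just before the node of rank [r] is due to join, zero
    for the first [s 0] ranks. The incentive pays only what this leaves missing. *)
Let p v := t v - sg (rank v).

Lemma chain_locate l r : l <= lam -> r < s l ->
  r < s 0 \/ exists2 i, i < l & s i <= r < s i.+1.
Proof.
elim: l => [|l IH] ll rl; first by left.
have [/IH[||[i il ir]]|lr] := ltnP r (s l); first exact: ltnW; first by left.
  by right; exists i => //; apply: ltnW.
by right; exists l => //; rewrite lr.
Qed.

Lemma chain_cost_upper : (forall v, t v <= n) -> incentive_cost p <= chain_cost lam s.
Proof.
move=> tn; rewrite /incentive_cost sum_layers //.
suff: \sum_(0 <= k < s lam) #|[set v | sg (rank v) <= k < t v]| <= chain_cost lam s.
  by rewrite s_last.
rewrite sum_chain //.
have slast l : l <= lam -> s l <= n.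
  by move=> ll; rewrite -s_last; apply: (chain_mono s_mono).
(* A node counted at height [k] has rank at least [below k.+1], as its threshold exceeds [k], and
   rank below [s l], as [sg] is at least [s l] on later ranks. *)
have layer l k : l <= lam -> k < s l ->
    #|[set v | sg (rank v) <= k < t v]| <= s l - below k.+1.
  move=> ll kl; set b := below _.
  have bn : b <= n by rewrite /b below_card -[X in _ <= X]card_ord max_card.
  have sub : [set v | sg (rank v) <= k < t v] \subset
             [set v | rank v < s l] :\: [set v | rank v < minn b (s l)].
    apply/subsetP => v; rewrite !inE => /andP[sgk ktv].
    have bv : b <= rank v by rewrite leqNgt rank_below -ltnNge.
    suff : rank v < s l by lia.
    rewrite ltnNge; apply/negP => lv.
    have vlam : rank v < s lam by rewrite s_last rank_lt.
    have [v0|[i il iv]] := chain_locate (leqnn lam) vlam.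
      by have := chain_mono s_mono (leq0n l) ll; lia.
    have sl : s l <= s i.
      have [/(chain_mono s_mono)->//|il'] := leqP l i; first exact: ltnW.
      by have := chain_mono s_mono il' ll; lia.
    by move: sgk; rewrite (sgS il iv); lia.
  apply: leq_trans (subset_leq_card sub) _.
  rewrite cardsD (_ : _ :&: _ = [set v | rank v < minn b (s l)]); last first.
    by apply/setP => v; rewrite !inE; lia.
  by rewrite !card_rank_lt ?slast // ?geq_min ?bn //; lia.
rewrite /chain_cost /gap; apply: leq_add.
  by rewrite !big_nat; apply: leq_sum => k /andP[_ ks]; apply: layer.
rewrite !big_nat; apply: leq_sum => i /andP[_ il].
by rewrite !big_nat; apply: leq_sum => k /andP[_ ks]; apply: layer.
Qed.

Lemma chain_feasible : TBI_feasible (@complete_nbhd n) t lam p.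
Proof.
split=> [v|]; first exact: leq_subr.
suff H l v : l <= lam -> rank v < s l -> v \in influenced (@complete_nbhd n) t p l.
  by apply/setP => v; rewrite inE H // s_last rank_lt.
elim: l v => [|l IH] v ll vl; first by rewrite inE /p sg0 // subn0.
rewrite /= !inE; have [/IH->//|lv] := ltnP (rank v) (s l); first exact: ltnW.
apply/orP; right; rewrite /p (sgS ll) ?lv //.
have sln : s l <= n by rewrite -s_last; apply: (chain_mono s_mono) => //; apply: ltnW.
apply: (@leq_trans (s l)); first lia.
(* The node itself has rank at least [s l], so its absence from its own neighbourhood loses none of
   the first [s l] nodes. *)
rewrite -[X in X <= _](card_rank_lt sln); apply/subset_leq_card/subsetP => u.
rewrite !inE => ul; rewrite (IH _ (ltnW ll) ul) andbT; apply: contraTneq ul => ->.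
by rewrite -leqNgt.
Qed.
End UpperBound.
End Combinatorics.

(** * Programs over interleaved arrays *)

(** Every slot is an array, and a scalar register is cell 0 of its slot. [Out] stands for the output
    area, which is laid out separately. *)
Inductive slot :=
  | Out | Below | Count | Prefix | Tri | Head | Cost | Arg | Sup
  | Idx | K | M | J | Low | High | Bj | Bv | X | Step | Pow | Row | Prev | L.

Definition code (a : slot) : nat :=
  match a with
  | Out => 0 | Below => 1 | Count => 2 | Prefix => 3 | Tri => 4 | Head => 5
  | Cost => 6 | Arg => 7 | Sup => 8 | Idx => 9 | K => 10 | M => 11 | J => 12
  | Low => 13 | High => 14 | Bj => 15 | Bv => 16 | X => 17 | Step => 18 | Pow => 19
  | Row => 20 | Prev => 21 | L => 22
  end.

Definition store := slot -> nat -> nat.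

Definition set_slot (st : store) a k x : store :=
  fun a' k' => if (code a' == code a) && (k' == k) then x else st a' k'.

Arguments set_slot st a k x a' k' /.

Inductive sexpr :=
  | Const of nat
  | Nodes
  | Rounds
  | At of slot & sexpr
  | Add of sexpr & sexpr
  | Sub of sexpr & sexpr
  | Half of sexpr
  | Lt of sexpr & sexpr
  | Eq of sexpr & sexpr.

Declare Scope sexpr_scope.
Delimit Scope sexpr_scope with sexpr.
Notation "a .[ e ]" := (At a e) : sexpr_scope.
Notation reg a := (At a (Const 0)).

Definition edouble e := EAdd e e.

(* Slots are interleaved after the input and output areas: cell [k] of slot [a]
   has address [2 n + 2 + 32 k + code a], so that all of them are unbounded. *)
Definition eaddr a e :=
  EAdd (EAdd (edouble (ELoad (ENum 0))) (ENum (2 + code a)))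
       (edouble (edouble (edouble (edouble (edouble e))))).

(** The output area is write-only: reading [Out] yields 0 by convention. *)
Fixpoint compile e :=
  match e with
  | Const k => ENum k
  | Nodes => ELoad (ENum 0)
  | Rounds => ELoad (ENum 1)
  | At a e1 => if a is Out then ENum 0 else ELoad (eaddr a (compile e1))
  | Add e1 e2 => EAdd (compile e1) (compile e2)
  | Sub e1 e2 => ESub (compile e1) (compile e2)
  | Half e1 => EHalf (compile e1)
  | Lt e1 e2 => ELt (compile e1) (compile e2)
  | Eq e1 e2 => EEq (compile e1) (compile e2)
  end.

Definition assign a e1 e2 :=
  CStore (if a is Out then EAdd (EAdd (ENum 2) (ELoad (ENum 0))) (compile e1)
          else eaddr a (compile e1)) (compile e2).
Definition read a e := CStore (eaddr a (ENum 0)) (ELoad (EAdd (ENum 2) (compile e))).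
Definition cond e c1 c2 := CIf (compile e) c1 c2.
Definition loop e c := CWhile (compile e) c.

Declare Scope cmd_scope.
Delimit Scope cmd_scope with cmd.
Notation "a # e1 ::= e2" := (assign a e1 e2)
  (at level 60, e1 at level 50, no associativity) : cmd_scope.
Notation "a ::= e2" := (assign a (Const 0) e2) (at level 60, no associativity) : cmd_scope.
Notation "c1 ;; c2" := (CSeq c1 c2) (at level 70, right associativity) : cmd_scope.

(** * Time-bounded execution on stores *)

Section Runs.
Variables (n lam : nat) (tt : nat -> nat).

Fixpoint value (st : store) e :=
  match e with
  | Const k => k
  | Nodes => n
  | Rounds => lam
  | At a e1 => if a is Out then 0 else st a (value st e1)
  | Add e1 e2 => value st e1 + value st e2
  | Sub e1 e2 => value st e1 - value st e2
  | Half e1 => (value st e1)./2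
  | Lt e1 e2 => nat_of_bool (value st e1 < value st e2)
  | Eq e1 e2 => nat_of_bool (value st e1 == value st e2)
  end.

Definition represents (m : memory) (st : store) : Prop :=
  [/\ m 0 = n, m 1 = lam, forall i, i < n -> m (2 + i) = tt i,
      forall i, i < n -> m (2 + n + i) = st Out i
    & forall a k, 0 < code a -> m (2 * n + 2 + code a + 32 * k) = st a k].

Lemma eval_eaddr m a e : m 0 = n ->
  eval m (eaddr a e) = 2 * n + 2 + code a + 32 * eval m e.
Proof. by move=> /= ->; lia. Qed.

Lemma eval_compile m st e : represents m st -> eval m (compile e) = value st e.
Proof.
case=> m0 m1 _ _ ms; elim: e => //=
  [a e IH|e1 -> e2 ->|e1 -> e2 ->|e ->|e1 -> e2 ->|e1 -> e2 ->] //.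
by case: a; rewrite //= m0 IH -ms //=; congr m; lia.
Qed.

(* [run c b st Q]: started in [st] with [b] units of time left, [c] terminates
   in a store [st'] with [b'] units left such that [Q b' st']. *)
Definition run (c : cmd) (b : nat) (st : store) (Q : nat -> store -> Prop) :=
  forall m, represents m st -> exists k m' b' st',
    [/\ exec c m k m', represents m' st', k + b' <= b & Q b' st'].

Lemma run_le b' c b st (Q : nat -> store -> Prop) :
  b' <= b -> run c b' st Q -> run c b st Q.
Proof.
move=> le H m /H[k [m' [b'' [st' [? ? ? ?]]]]].
by exists k, m', b'', st'; split=> //; lia.
Qed.

Lemma run_skip b st (Q : nat -> store -> Prop) : Q b st -> run CSkip b.+1 st Q.
Proof. by move=> H m R; exists 1, m, b, st; split=> //; constructor. Qed.

Lemma run_assign a e1 e2 b st (Q : nat -> store -> Prop) :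
  (if a is Out then value st e1 < n else true) ->
  Q b (set_slot st a (value st e1) (value st e2)) -> run (assign a e1 e2) b.+1 st Q.
Proof.
move=> ok H m R; exists 1, (upd m (eval m (match a with Out =>
   EAdd (EAdd (ENum 2) (ELoad (ENum 0))) (compile e1) | _ => eaddr a (compile e1) end))
   (value st e2)), b.
exists (set_slot st a (value st e1) (value st e2)); split=> //.
  by rewrite -(eval_compile _ R); constructor.
have E1 := eval_compile e1 R; have [m0 m1 mi mo ms] := R.
have -> : eval m (match a with Out =>
   EAdd (EAdd (ENum 2) (ELoad (ENum 0))) (compile e1) | _ => eaddr a (compile e1) end) =
   if a is Out then 2 + n + value st e1 else 2 * n + 2 + code a + 32 * value st e1.
  by rewrite -E1 -(eval_eaddr _ _ m0); case: {ok H} a; rewrite //= m0.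
rewrite /upd /set_slot.
have [a0|apos] : a = Out \/ 0 < code a by case: {ok H} a; [left|right..].
  rewrite a0 in ok *; split=> [|||i il|a' k a'pos].
  - exact: m0.
  - exact: m1.
  - by move=> i il; rewrite /= ifF ?mi //; lia.
  - by rewrite /= eqn_add2l mo.
  by rewrite /= ifF ?[code a' == _]eqn0Ngt ?a'pos ?ms //; lia.
have -> : (if a is Out then 2 + n + value st e1 else 2 * n + 2 + code a + 32 * value st e1)
   = 2 * n + 2 + code a + 32 * value st e1 by case: {H ok} a apos.
split=> [|||i il|a' k a'pos].
- by rewrite ifF //; lia.
- by rewrite ifF //; lia.
- by move=> i il; rewrite /= ifF ?mi //; lia.
- by rewrite !ifF ?mo //; case: {H ok} a apos; rewrite //=; lia.
(* Codes below 32 make an address determine both the slot and the cell. *)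
have c32 x : code x < 32 by case: x.
rewrite -ms // (_ : (_ == _) = (code a' == code a) && (k == value st e1)) //.
by have := c32 a; have := c32 a'; lia.
Qed.

(** Under [represents] the input cells keep the thresholds, so a read acts as the assignment of a
    constant. *)
Lemma run_read a e b st (Q : nat -> store -> Prop) :
  0 < code a -> value st e < n ->
  Q b (set_slot st a 0 (tt (value st e))) -> run (read a e) b.+1 st Q.
Proof.
move=> apos ok H m R; have [m0 m1 mi mo ms] := R.
pose c := Const (tt (value st e)).
have H' : run (assign a (Const 0) c) b.+1 st Q by apply: run_assign; [case: (a) apos | exact: H].
have [k [m' [b' [st' [ex R' kb Qb]]]]] := H' m R.
exists k, m', b', st'; split=> //.
have El : eval m (ELoad (EAdd (ENum 2) (compile e))) = eval m (ENum (tt (value st e))).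
  by rewrite /= (eval_compile _ R) mi.
inversion ex; subst; have := ExStore (eaddr a (ENum 0)) (ELoad (EAdd (ENum 2) (compile e))) m.
by rewrite El; case: (a) apos.
Qed.

Lemma run_seq c1 c2 b st (Q : nat -> store -> Prop) :
  run c1 b st (fun b' st' => run c2 b' st' Q) -> run (CSeq c1 c2) b st Q.
Proof.
move=> H m /H[k1 [m1 [b1 [st1 [? R1 ? /(_ _ R1)[k2 [m2 [b2 [st2 [? ? ? ?]]]]]]]]]].
by exists (k1 + k2), m2, b2, st2; split=> //; [econstructor; eassumption|lia].
Qed.

Lemma run_cond (B : bool) e c1 c2 b st (Q : nat -> store -> Prop) :
  (value st e != 0) = B -> (B -> run c1 b st Q) -> (~~ B -> run c2 b st Q) ->
  run (cond e c1 c2) b.+1 st Q.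
Proof.
move=> E H1 H2 m R; have Ee := eval_compile e R.
case: B E H1 H2 => E H1 H2.
  have [k [m' [b' [st' [? ? ? ?]]]]] := H1 isT m R.
  by exists k.+1, m', b', st'; split=> //; apply: ExIfT => //; rewrite Ee E.
have [k [m' [b' [st' [? ? ? ?]]]]] := H2 isT m R.
exists k.+1, m', b', st'; split=> //; apply: ExIfF => //; rewrite Ee.
by apply/eqP; rewrite -[_ == _]negbK E.
Qed.

(** The remaining budget doubles as the variant: each test uses up at least one unit, hence the loop
    terminates. *)
Lemma run_loop (Inv : nat -> store -> Prop) e c b st (Q : nat -> store -> Prop) :
  Inv b st ->
  (forall b st, Inv b st -> exists2 b1, b1 < b &
     if value st e != 0 then run c b1 st Inv else Q b1 st) ->
  run (loop e c) b st Q.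
Proof.
move=> Ib step; have [N bN] := ubnP b; elim: N => // N IH in b st Ib bN *.
move=> m R; have [b1 b1b] := step _ _ Ib; have Ee := eval_compile e R.
case: ifPn => E.
  case/(_ m R) => k1 [m1 [b2 [st1 [ex1 R1 kb Ib1]]]].
  have [|k2 [m2 [b3 [st2 [ex2 R2 kb2 Q2]]]]] := IH b2 st1 Ib1 _ m1 R1; first lia.
  exists (k1 + k2).+1, m2, b3, st2; split=> //; last lia.
  by apply: ExWhileT ex1 ex2; rewrite Ee.
move=> HQ; exists 1, m, b1, st; split=> //.
by apply: ExWhileF; rewrite Ee; apply/eqP; rewrite -[_ == _]negbK.
Qed.
End Runs.

(** * The algorithm *)

Local Open Scope sexpr_scope.
Local Open Scope cmd_scope.

Definition count_thresholds :=
  Idx ::= Const 0;;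
  loop (Lt (reg Idx) Nodes)
    (read K (reg Idx);;
     Count # reg K ::= Add (Count.[reg K]) (Const 1);;
     Idx ::= Add (reg Idx) (Const 1)).

(** The tables extend past [n + n] because [Mul] looks up triangular numbers at sums of two indices
    that are at most [n]. *)
Definition tabulate :=
  Idx ::= Const 0;;
  loop (Lt (reg Idx) (Add (Add Nodes Nodes) (Const 1)))
    (Below # (Add (reg Idx) (Const 1)) ::= Add (Below.[reg Idx]) (Count.[reg Idx]);;
     Prefix # (Add (reg Idx) (Const 1)) ::=
       Add (Prefix.[reg Idx]) (Below.[Add (reg Idx) (Const 1)]);;
     Tri # (Add (reg Idx) (Const 1)) ::= Add (Tri.[reg Idx]) (reg Idx);;
     Idx ::= Add (reg Idx) (Const 1)).

(* [x * y = 'C(x + y, 2) - 'C(x, 2) - 'C(y, 2)] *)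
Definition Mul x y := Sub (Sub (Tri.[Add x y]) (Tri.[x])) (Tri.[y]).

(** A two-pointer sweep: as [M] grows, the index [K] from which the terms of [gap 0 M] vanish never
    moves back. The conjunction is tested by comparing the sum of two bits with 2. *)
Definition init_row :=
  M ::= Const 0;; K ::= Const 0;;
  loop (Lt (reg M) (Add Nodes (Const 1)))
    (cond (Eq (Add (Lt (reg K) (reg M)) (Lt (Below.[Add (reg K) (Const 1)]) (reg M))) (Const 2))
       (K ::= Add (reg K) (Const 1))
       (Head # reg M ::= Sub (Mul (reg M) (reg K)) (Prefix.[reg K]);;
        Cost # reg M ::= Head.[reg M];;
        M ::= Add (reg M) (Const 1))).

Definition init_stride :=
  Pow ::= Const 1;; loop (Lt (reg Pow) (Add Nodes (Const 1))) (Pow ::= Add (reg Pow) (reg Pow)).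

Definition candidate :=
  cond (Lt (Below.[Add (reg J) (Const 1)]) (reg M))
    (X ::= Add (Cost.[Add (reg Prev) (reg J)])
               (Sub (Add (Head.[reg M]) (Prefix.[reg J])) (Mul (reg M) (reg J))))
    (X ::= Cost.[Add (reg Prev) (reg J)]).

(** The candidate at [Low] is accepted unconditionally, so [Bv] and [Bj] need no initial value. *)
Definition scan :=
  J ::= reg Low;;
  loop (Lt (reg J) (Add (reg High) (Const 1)))
    (candidate;;
     cond (Add (Eq (reg J) (reg Low)) (Lt (reg X) (reg Bv)))
       (Bv ::= reg X;; Bj ::= reg J) CSkip;;
     J ::= Add (reg J) (Const 1)).

(** The argmins of the two neighbouring columns bracket the search; if the right neighbour lies past
    [n], only the bound [M] remains. *)
Definition bounds :=
  Low ::= Arg.[Add (reg Row) (Sub (reg M) (reg Step))];;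
  High ::= reg M;;
  cond (Lt (Add (reg M) (reg Step)) (Add Nodes (Const 1)))
    (cond (Lt (Arg.[Add (reg Row) (Add (reg M) (reg Step))]) (reg M))
       (High ::= Arg.[Add (reg Row) (Add (reg M) (reg Step))]) CSkip) CSkip.

Definition column :=
  bounds;;
  scan;;
  Arg # (Add (reg Row) (reg M)) ::= reg Bj;;
  Cost # (Add (reg Row) (reg M)) ::= reg Bv;;
  M ::= Add (reg M) (Add (reg Step) (reg Step)).

Definition refine :=
  Step ::= Half (reg Step);; M ::= reg Step;;
  loop (Lt (reg M) (Add Nodes (Const 1))) column.

(** [Prev] and [Row] are the offsets of the previous and the current row in flat arrays. Column 0,
    whose only candidate is 0, seeds the coarsest stride. *)
Definition layer :=
  Prev ::= reg Row;;
  Row ::= Add (reg Row) (Add Nodes (Const 1));;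
  Arg # reg Row ::= Const 0;;
  Cost # reg Row ::= Cost.[reg Prev];;
  Step ::= reg Pow;;
  loop (Lt (Const 1) (reg Step)) refine;;
  L ::= Add (reg L) (Const 1).

Definition layers :=
  Row ::= Const 0;; L ::= Const 0;; loop (Lt (reg L) Rounds) layer.

(** Walks the recorded argmins back from [n] and tabulates in [Sup], by rank, the function [sg] of
    the upper bound. *)
Definition retrace :=
  K ::= Nodes;;
  loop (Lt (Const 0) (reg L))
    (M ::= Arg.[Add (reg Row) (reg K)];;
     Idx ::= reg M;;
     loop (Lt (reg Idx) (reg K))
       (Sup # reg Idx ::= reg M;; Idx ::= Add (reg Idx) (Const 1));;
     K ::= reg M;;
     Row ::= Sub (reg Row) (Add Nodes (Const 1));;
     L ::= Sub (reg L) (Const 1)).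

(** As in counting sort, [Below.[k]] holds the next free rank among the nodes of threshold [k]. *)
Definition emit :=
  Idx ::= Const 0;;
  loop (Lt (reg Idx) Nodes)
    (read K (reg Idx);;
     X ::= Below.[reg K];;
     Below # reg K ::= Add (reg X) (Const 1);;
     Out # reg Idx ::= Sub (reg K) (Sup.[reg X]);;
     Idx ::= Add (reg Idx) (Const 1)).

(** The guard keeps the empty network, whose time bound is constant, from looping over the
    rounds. *)
Definition program :=
  cond Nodes
    (count_thresholds;; tabulate;; init_row;; init_stride;; layers;; retrace;; emit)
    CSkip.

(** * Correctness and time of each phase *)

Section Correctness.
Variables (n lam : nat) (t : 'I_n -> nat) (tt : nat -> nat).
Hypothesis tt_t : forall v : 'I_n, tt v = t v.
Hypothesis t_range : forall v : 'I_n, 1 <= t v <= n.-1.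

Notation run := (run n lam tt).

Definition frame (l : seq slot) (st st' : store) :=
  forall a k, code a \notin map code l -> st' a k = st a k.

Ltac solve_frame FR := let a := fresh in let k := fresh in
  move=> a k; have := FR a k; case: a.

Definition tables (st : store) := forall k, k <= n + n + 1 ->
  [/\ st Below k = below t k, st Prefix k = \sum_(0 <= i < k) below t i.+1
    & st Tri k = 'C(k, 2)].

Lemma bin2D x y : 'C(x + y, 2) = 'C(x, 2) + 'C(y, 2) + x * y.
Proof.
elim: y => [|y IH]; first by rewrite addn0 muln0 !addn0.
by rewrite addnS !binS !bin1 IH; lia.
Qed.

Lemma below_sum k : below t k = \sum_(0 <= i < n) (tt i < k).
Proof. by rewrite big_mkord; apply: eq_bigr => v _; rewrite tt_t. Qed.

(** Like the later phases, this one is specified with a continuation: given [b] units beyond its own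
    cost, it hands at least [b] units on to [Q]. *)
Lemma run_count b st (Q : nat -> store -> Prop) :
  (forall k, st Count k = 0) ->
  (forall st', frame [:: Idx; K; Count] st st' ->
     (forall k, st' Count k = \sum_(0 <= i < n) (tt i == k)) -> Q b st') ->
  run count_thresholds (b + 4 * n + 2) st Q.
Proof.
move=> C0 HQ; apply: run_seq; rewrite addn2; apply: run_assign => //=.
pose Inv b' st' := exists i, [/\ i <= n, st' Idx 0 = i,
  b' = b + 4 * (n - i) + 1, frame [:: Idx; K; Count] st st'
  & forall k, st' Count k = \sum_(0 <= u < i) (tt u == k)].
apply: (@run_loop _ _ _ Inv).
  exists 0; split=> //=; [lia| |].
    by move=> a k; case: a.
  by move=> k /=; rewrite big_geq // C0.
move=> b' st' [i [il Ii -> FR Cnt]].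
rewrite /= Ii; case: (ltnP i n) => /= [lin|nin]; last first.
  have ein : i = n by lia.
  by exists b; [lia|apply: HQ => // k; rewrite Cnt ein].
exists (b + 4 * (n - i.+1) + 1).+3; first lia.
apply: run_seq; apply: run_read; rewrite //= ?Ii //.
apply: run_seq; apply: run_assign => //=; apply: run_assign => //=.
exists i.+1; split=> //=; first by rewrite Ii addn1.
  by solve_frame FR.
move=> k; rewrite big_nat_recr //= -Cnt /set_slot /= [k == _]eq_sym.
by case: eqP => [<-|_]; rewrite ?addn0.
Qed.

Lemma run_tabulate b st (Q : nat -> store -> Prop) :
  st Below 0 = 0 -> st Prefix 0 = 0 -> st Tri 0 = 0 ->
  (forall k, st Count k = \sum_(0 <= i < n) (tt i == k)) ->
  (forall st', frame [:: Idx; Below; Prefix; Tri] st st' -> tables st' -> Q b st') ->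
  run tabulate (b + 5 * (n + n + 1) + 2) st Q.
Proof.
move=> B0 P0 T0 Cnt HQ; apply: run_seq; rewrite addn2; apply: run_assign => //=.
pose Inv b' st' := exists i, [/\ i <= n + n + 1, st' Idx 0 = i,
  b' = b + 5 * (n + n + 1 - i) + 1, frame [:: Idx; Below; Prefix; Tri] st st'
  & forall k, k <= i -> [/\ st' Below k = below t k,
     st' Prefix k = \sum_(0 <= i < k) below t i.+1 & st' Tri k = 'C(k, 2)]].
apply: (@run_loop _ _ _ Inv).
  exists 0; split=> //=; [lia| |].
    by move=> a k; case: a.
  move=> k; rewrite leqn0 => /eqP->; rewrite /= big_geq // B0 P0 T0; split=> //.
  by rewrite /below big1.
move=> b' st' [i [il Ii -> FR Tab]].
rewrite /= Ii; case: (ltnP i (n + n + 1)) => /= [lin|nin]; last first.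
  have ein : i = n + n + 1 by lia.
  by exists b; [lia|apply: HQ => //; rewrite /tables -ein].
exists (b + 5 * (n + n + 1 - i.+1) + 1).+4; first lia.
do 3![apply: run_seq; apply: run_assign => //=]; apply: run_assign => //=.
exists i.+1; split=> //=; first by rewrite Ii addn1.
  by solve_frame FR.
have [Bi Pi Ti] := Tab i (leqnn i).
have Bi1 : below t i.+1 = below t i + st' Count i.
  rewrite (FR Count) // Cnt !below_sum -big_split /=; apply: eq_bigr => u _; lia.
move=> k; rewrite /set_slot /= !eqxx ?Ii !addn1 leq_eqVlt => /predU1P[->|ki].
  by rewrite !eqxx Bi Pi Ti -Bi1 big_nat_recr //= binS bin1.
by rewrite !ifF ?(ltn_eqF ki) //; apply: Tab.
Qed.

Lemma tables_frame l st st' : tables st -> frame l st st' ->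
  [&& code Below \notin map code l, code Prefix \notin map code l
    & code Tri \notin map code l] -> tables st'.
Proof. by move=> T FR /and3P[B P Tr] k kn; rewrite !FR //; apply: T. Qed.

Lemma value_mul st x y : tables st ->
  value n lam st x + value n lam st y <= n + n + 1 ->
  value n lam st (Mul x y) = value n lam st x * value n lam st y.
Proof.
move=> T le /=; set u := value _ _ _ x in le *; set v := value _ _ _ y in le *.
have [|_ _ ->] := T (u + v) _ => //; have [|_ _ ->] := T u _; first lia.
by have [|_ _ ->] := T v _; rewrite ?bin2D; lia.
Qed.

Lemma run_init_row b st (Q : nat -> store -> Prop) :
  tables st ->
  (forall st', frame [:: K; M; Head; Cost] st st' ->
     (forall m, m <= n -> st' Head m = gap t 0 m /\ st' Cost m = gap t 0 m) ->
     Q b st') ->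
  run init_row (b + 8 * n + 8) st Q.
Proof.
move=> Tab HQ.
have -> : b + 8 * n + 8 = (b + 5 * (n + 1) + 3 * n + 1).+2 by lia.
do 2![apply: run_seq; apply: run_assign => //=].
(* Every pass advances either [m] at price 5 or [k] at price 3. *)
pose Inv b' st' := exists m k, [/\ st' M 0 = m, st' K 0 = k,
  b' = b + 5 * (n.+1 - m) + 3 * (n - k) + 1, frame [:: K; M; Head; Cost] st st'
  & [/\ m <= n.+1, k <= n, k <= m, forall k', k' < k -> below t k'.+1 < m
      & forall m', m' < m -> st' Head m' = gap t 0 m' /\ st' Cost m' = gap t 0 m']].
apply: (@run_loop _ _ _ Inv).
  exists 0, 0; split=> //=; [lia|].
  by move=> a k; case: a.
move=> b' st' [m [k [Mm Kk -> FR [mn kn km lo Hm]]]].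
have T' := tables_frame Tab FR isT.
rewrite /= Mm [n + 1]addn1; case: (ltnP m n.+1) => /= [mn1|nm]; last first.
  by exists b; [lia|apply: HQ => // m' m'n; apply: Hm; lia].
have [|Bk _ _] := T' k.+1 _; first lia.
have [//|_ Pk _] := T' k _; first lia.
exists (b + 5 * (n.+1 - m) + 3 * (n - k)).-1.+1; first lia.
apply: (run_cond (B := (k < m) && (below t k.+1 < m))).
- by rewrite /= Mm Kk addn1 Bk; case: (_ < _); case: (_ < _).
- case/andP=> km' bm.
  apply: (@run_le _ _ _ (b + 5 * (n.+1 - m) + 3 * (n - k.+1) + 1).+1); first lia.
  apply: run_assign => //=; exists m, k.+1; split=> //=; first by rewrite Kk addn1.
    by solve_frame FR.
  split=> //; first lia.
  by move=> k'; rewrite ltnS leq_eqVlt => /predU1P[->//|]; apply: lo.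
rewrite negb_and -!leqNgt => stop.
apply: (@run_le _ _ _ (b + 5 * (n.+1 - m.+1) + 3 * (n - k) + 1).+3); first lia.
have E : value n lam st' (Sub (Mul (reg M) (reg K)) (Prefix.[reg K])) = gap t 0 m.
  have EM := @value_mul st' (reg M) (reg K) T' _.
  change (value n lam st' (Mul (reg M) (reg K)) - st' Prefix (st' K 0) = gap t 0 m).
  rewrite EM /= ?Mm ?Kk; last lia.
  rewrite Pk -(@gap_head _ t k m) ?addnK // => kltm.
  by move: stop; rewrite leqNgt kltm.
apply: run_seq; apply: run_assign => //; rewrite E.
apply: run_seq; do 2![apply: run_assign => //=].
exists m.+1, k; split=> //=; [by rewrite Mm addn1|by solve_frame FR|split=> //].
- lia.
- by move=> k' /lo; lia.
move=> m'; rewrite Mm eqxx ltnS leq_eqVlt => /predU1P[->|m'm]; first by rewrite !eqxx.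
by rewrite ltn_eqF //; apply: Hm.
Qed.

Lemma run_init_stride b st (Q : nat -> store -> Prop) : 0 < n ->
  (forall st' r, frame [:: Pow] st st' -> st' Pow 0 = 2 ^ r -> n < 2 ^ r ->
     r <= (trunc_log 2 n).+1 -> Q b st') ->
  run init_stride (b + 2 * (trunc_log 2 n).+1 + 2) st Q.
Proof.
move=> n0 HQ; apply: run_seq; rewrite addn2; apply: run_assign => //=.
set l := (trunc_log 2 n).+1.
pose Inv b' st' := exists r, [/\ r <= l, st' Pow 0 = 2 ^ r,
  b' = b + 2 * (l - r) + 1 & frame [:: Pow] st st'].
apply: (@run_loop _ _ _ Inv).
  exists 0; split=> //=; [lia|].
  by move=> a k; case: a.
move=> b' st' [r [rl Pr -> FR]].
rewrite /= Pr [n + 1]addn1 ltnS; case: leqP => /= [rn|nr]; last first.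
  by exists b; [lia|apply: (HQ _ r)].
have rl' : r < l by rewrite ltnS; apply: trunc_log_max.
exists (b + 2 * (l - r.+1) + 1).+1; first lia.
apply: run_assign => //=; exists r.+1; split=> //=; last by solve_frame FR.
by rewrite Pr expnS; lia.
Qed.

Lemma run_candidate b st j m (Q : nat -> store -> Prop) :
  tables st -> st Head m = gap t 0 m -> st J 0 = j -> st M 0 = m -> j <= m <= n ->
  Q b (set_slot st X 0 (st Cost (st Prev 0 + j) + gap t j m)) ->
  run candidate b.+2 st Q.
Proof.
move=> Tab Hm Jj Mm /andP[jm mn] HQ.
have [|Bj _ _] := Tab j.+1 _; first lia.
have [|_ Pj _] := Tab j _; first lia.
apply: (run_cond (B := below t j.+1 < m)).
- by rewrite /= Mm Jj addn1 Bj; case: (_ < _).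
- move=> bm; apply: run_assign => //.
  rewrite [value _ _ _ (Add _ _)](_ : _ = st Cost (st Prev 0 + j) + gap t j m) //.
  have EM := @value_mul st (reg M) (reg J) Tab _.
  change (st Cost (st Prev 0 + st J 0) + (st Head (st M 0) + st Prefix (st J 0)
    - value n lam st (Mul (reg M) (reg J))) = st Cost (st Prev 0 + j) + gap t j m).
  rewrite EM /= ?Mm ?Jj; last lia.
  by rewrite Hm Pj -gap_prefix // addnK.
rewrite -leqNgt => mb; apply: run_assign => //.
by rewrite gap_eq0 // addn0 in HQ; rewrite /= Jj.
Qed.

Lemma run_scan b st m lo hi (Q : nat -> store -> Prop) :
  let e j := st Cost (st Prev 0 + j) in
  tables st -> st Head m = gap t 0 m -> st M 0 = m -> st Low 0 = lo -> st High 0 = hi ->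
  lo <= hi -> hi <= m <= n ->
  (forall st', frame [:: J; X; Bv; Bj] st st' ->
     lo <= st' Bj 0 <= hi -> st' Bv 0 = e (st' Bj 0) + gap t (st' Bj 0) m ->
     (forall j, lo <= j <= hi -> st' Bv 0 <= e j + gap t j m) -> Q b st') ->
  run scan (b + 7 * (hi.+1 - lo) + 2) st Q.
Proof.
move=> e Tab Hm Mm Lo Hi lohi /andP[him mn] HQ.
apply: run_seq; rewrite addn2; apply: run_assign => //=; rewrite Lo.
(* Nothing is claimed of [Bj] and [Bv] before the first candidate has been stored. *)
pose Inv b' st' := exists j, [/\ lo <= j <= hi.+1, st' J 0 = j,
  b' = b + 7 * (hi.+1 - j) + 1, frame [:: J; X; Bv; Bj] st st'
  & lo < j -> [/\ lo <= st' Bj 0 < j, st' Bv 0 = e (st' Bj 0) + gap t (st' Bj 0) m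
      & forall i, lo <= i < j -> st' Bv 0 <= e i + gap t i m]].
apply: (@run_loop _ _ _ Inv).
  exists lo; split=> //=; try lia.
  by move=> a k; case: a.
move=> b' st' [j [/andP[loj jhi] Jj -> FR best]].
have T' := tables_frame Tab FR isT.
rewrite /= (FR High) // Hi Jj [hi + 1]addn1; case: (ltnP j hi.+1) => /= [jh|hj]; last first.
  exists b; first lia; have [|bj bv mi] := best; first lia.
  by apply: HQ => // [|i ih]; [lia|apply: mi; lia].
exists (b + 7 * (hi.+1 - j.+1) + 1).+4.+2; first lia.
apply: run_seq; apply: (run_candidate (j := j) (m := m)) => //.
- by rewrite (FR Head).
- by rewrite (FR M).
- lia.
rewrite (FR Cost) // (FR Prev) // -/(e j).
apply: run_seq; apply: (run_cond (B := (j == lo) || (e j + gap t j m < st' Bv 0))).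
- by rewrite /= Jj (FR Low) // Lo; case: (j == lo); case: (e j + _ < _).
- move=> better; apply: run_seq; do 3![apply: run_assign => //=].
  exists j.+1; split=> //=; [lia|by rewrite Jj addn1|by solve_frame FR|].
  move=> _; rewrite Jj leqnn loj; split=> // i /andP[loi].
  rewrite ltnS leq_eqVlt => /predU1P[->//|ij].
  have [|_ _ mi] := best; first lia.
  by have := mi i; rewrite loi ij; lia.
rewrite negb_or -leqNgt => /andP[jlo worse]; apply: run_skip.
apply: (@run_le _ _ _ (b + 7 * (hi.+1 - j.+1) + 1).+1); first lia.
apply: run_assign => //=.
have [|/andP[? ?] ? mi] := best; first lia.
exists j.+1; split=> //=; [lia|by rewrite Jj addn1|by solve_frame FR|].
move=> _; split=> //; first lia.
by move=> i /andP[loi]; rewrite ltnS leq_eqVlt => /predU1P[->//|ij]; apply: mi; lia.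
Qed.

Lemma run_bounds b st (Q : nat -> store -> Prop) :
  let m := st M 0 in let s := st Step 0 in let arg k := st Arg (st Row 0 + k) in
  (forall st', frame [:: Low; High] st st' -> st' Low 0 = arg (m - s) ->
     st' High 0 = (if m + s <= n then minn (arg (m + s)) m else m) -> Q b st') ->
  run bounds (b + 5) st Q.
Proof.
move=> m s arg HQ; rewrite addnC.
do 2![apply: run_seq; apply: run_assign => //=]; rewrite -/m -/s -/(arg _).
have FR st1 : frame [:: Low; High] st (set_slot (set_slot st1 Low 0 (arg (m - s))) High 0 m) <->
  frame [:: Low; High] st st1 by split=> FR a k; have := FR a k; case: a.
apply: (run_cond (B := m + s <= n)).
- by rewrite /= -/m -/s addn1 ltnS; case: (_ <= _).
- move=> msn; rewrite msn in HQ; apply: (run_cond (B := arg (m + s) < m)).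
  + by rewrite /= -/m -/s -/(arg _); case: (_ < _).
  + move=> lt; apply: run_assign => //=; rewrite -/m -/s -/(arg _).
    apply: HQ => //=; last lia.
    by move=> a k; case: a.
  rewrite -leqNgt => le; apply: run_skip.
  by apply: HQ => //=; [apply/FR|lia].
rewrite -ltnNge => nms; apply: (@run_le _ _ _ b.+1) => //; apply: run_skip.
by apply: HQ => //=; [apply/FR|rewrite leqNgt nms].
Qed.

(** * One round: refining the stride *)

Section Layer.
Variable st0 : store.
Let e j := st0 Cost (st0 Prev 0 + j).
Let row := st0 Row 0.
Hypotheses (tables0 : tables st0) (head0 : forall m, m <= n -> st0 Head m = gap t 0 m).
Hypothesis row_prev : row = st0 Prev 0 + n.+1.

Definition layer_slots := [:: Low; High; J; X; Bv; Bj; M; Step; Arg; Cost].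

(** The frame lets [Arg] and [Cost] change, so the second clause protects the earlier rows. *)
Definition in_layer (st : store) := frame layer_slots st0 st /\
  forall k, k < row -> st Arg k = st0 Arg k /\ st Cost k = st0 Cost k.

Definition column_ok m (st : store) :=
  best t e m (st Arg (row + m)) /\
  st Cost (row + m) = e (st Arg (row + m)) + gap t (st Arg (row + m)) m.

(* The columns whose index is a multiple [s * a] of the stride are filled in
   when [a] is even (by the coarser strides) or smaller than [i]; the recorded
   argmins are moreover monotone, hence amortize the scans. *)
Definition filled s i (st : store) :=
  (forall a, s * a <= n -> ~~ odd a || (a < i) -> column_ok (s * a) st) /\
  (forall a a', s * a' <= n -> ~~ odd a || (a < i) -> ~~ odd a' || (a' < i) ->
     a <= a' -> st Arg (row + s * a) <= st Arg (row + s * a')).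

(** The potential [7 * (n - argmin)] of the left neighbour pays for the scan, which stops no later
    than the argmin of the right neighbour, where the next scan of this stride starts. *)
Lemma run_column b st s i (Q : nat -> store -> Prop) : 0 < s -> odd i -> s * i <= n ->
  in_layer st -> st Step 0 = s -> st M 0 = s * i -> filled s i st ->
  (forall b' st', in_layer st' -> st' Step 0 = s -> st' M 0 = s * i.+2 -> filled s i.+2 st' ->
     b <= b' -> (s * i.+2 <= n -> b + 7 * (n - st' Arg (row + s * i.+1)) <= b') -> Q b' st') ->
  run column (b + 7 * (n - st Arg (row + s * i.-1)) + 17) st Q.
Proof.
move=> s0 oi sin [FR old] Ss Mm [ok mono] HQ.
have i0 : 0 < i by case: (i) oi.
have ei1 : ~~ odd i.-1 by move: oi; rewrite -{1}(prednK i0) oddS.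
have ei2 : ~~ odd i.+1 by rewrite oddS oi.
set lo := st Arg (row + s * i.-1); set m := s * i in sin Mm *.
have ms : m - s = s * i.-1 by rewrite -{1}(muln1 s) -mulnBr subn1.
have mS : m + s = s * i.+1 by rewrite mulnS addnC.
have mSS : m + (s + s) = s * i.+2 by rewrite !mulnS -/m; lia.
set hi := if m + s <= n then minn (st Arg (row + (m + s))) m else m.
have him : hi <= m by rewrite /hi; case: ifP => //; lia.
have [[lo_le lo_best] _] : column_ok (s * i.-1) st by apply: ok; rewrite ?ei1 //; lia.
rewrite -/lo in lo_le lo_best.
have lohi : lo <= hi.
  rewrite /hi; case: ifP => [msn|_]; last lia.
  rewrite leq_min mS mono ?ei1 ?ei2 //; [lia|by rewrite -mS|lia].
(* The scan takes [7 * (hi.+1 - lo)]; the part [7 * (n - hi)] is left as potential for the next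
   column. *)
apply: (@run_le _ _ _ (b + 7 * (n - hi) + 3 + 7 * (hi.+1 - lo) + 2 + 5)); first lia.
apply: run_seq; apply: run_bounds => st1 FR1 Lo1 Hi1.
rewrite Mm Ss (FR Row) // -/row in Lo1 Hi1; rewrite ms -/lo in Lo1; rewrite -/hi in Hi1.
have FR01 : frame layer_slots st0 st1.
  by move=> a k; have := FR a k; have := FR1 a k; case: a => //= ->.
apply: run_seq; apply: (run_scan (m := m) (lo := lo) (hi := hi)) => //.
- exact: tables_frame tables0 FR01 isT.
- by rewrite (FR01 Head) // head0.
- by rewrite (FR1 M).
- by rewrite him.
move=> st2 FR2; set x := st2 Bj 0 => /andP[lox xhi].
have e1 j : j <= n -> st1 Cost (st1 Prev 0 + j) = e j.
  by move=> jn; rewrite (FR1 Cost) // (FR01 Prev) // (old _ _).2 //; lia.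
rewrite e1 => [Bv2 min2|]; last lia.
(* Indices left of [lo] or right of [hi] are no better than [lo] or [hi] by the Monge inequality,
   and both ends have been scanned. *)
have bestx : best t e m x.
  split=> [|j jm]; first lia.
  rewrite -Bv2; have [jlo|loj] := ltnP j lo.
    have := @best_left _ t e _ m lo j (conj lo_le lo_best) _ _.
    have := min2 lo; rewrite leqnn lohi e1; lia.
  have [jhi|hij] := leqP j hi; first by have := min2 j; rewrite loj jhi e1; lia.
  have [msn hia] : m + s <= n /\ hi = st Arg (row + (m + s)).
    by move: hij; rewrite /hi; case: ifP => //; lia.
  have [hb _] : column_ok (s * i.+1) st by apply: ok; rewrite ?ei2 // -mS.
  rewrite -mS -hia in hb.
  have := @best_right _ t e _ m hi j hb _ _ jm.
  have := min2 hi; rewrite leqnn lohi e1; lia.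
have FR02 : frame layer_slots st0 st2.
  by move=> a k; have := FR01 a k; have := FR2 a k; case: a => //= ->.
have r2 : st2 Row 0 = row by rewrite (FR02 Row).
have M2 : st2 M 0 = m by rewrite (FR2 M) // (FR1 M).
have S2 : st2 Step 0 = s by rewrite (FR2 Step) // (FR1 Step).
have A2 k : st2 Arg k = st Arg k by rewrite (FR2 Arg) // (FR1 Arg).
have C2 k : st2 Cost k = st Cost k by rewrite (FR2 Cost) // (FR1 Cost).
rewrite addn3; do 2![apply: run_seq; apply: run_assign => //=]; apply: run_assign => //=.
rewrite -/x Bv2 r2 M2 S2 mSS.
set st3 := set_slot _ M _ _.
have Arg3 a : st3 Arg (row + s * a) = if a == i then x else st Arg (row + s * a).
  by rewrite /st3 /= A2 eqn_add2l eqn_pmul2l.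
have Cost3 a : st3 Cost (row + s * a) =
    if a == i then e x + gap t x m else st Cost (row + s * a).
  by rewrite /st3 /= C2 eqn_add2l eqn_pmul2l.
(* As [i] is odd, raising the bound by two adds the single column [i]. *)
have odd2 a : ~~ odd a || (a < i.+2) -> a != i -> ~~ odd a || (a < i).
  by case oa: (odd a) => //= ai ai'; have : a != i.+1 by [apply: contraTneq oa => ->]; lia.
have hiS a : s * a <= n -> i < a -> hi <= st Arg (row + (m + s)) /\ s * i.+1 <= n.
  move=> san ia; have sn : s * i.+1 <= n by apply: leq_trans san; rewrite leq_mul2l ia orbT.
  by split=> //; rewrite /hi mS sn geq_minl.
apply: HQ => //.
- split; first by move=> a k; have := FR02 a k; case: a.
  by move=> k kr; rewrite /st3 /= !ifF ?A2 ?C2; [exact: old|lia|lia].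
- split=> [a san aP|a a' san aP a'P aa'].
    have [ai|ai] := eqVneq a i; last first.
      by rewrite /column_ok Arg3 Cost3 (negPf ai); apply: ok (odd2 _ _ _).
    by rewrite /column_ok Arg3 Cost3 ai eqxx.
  rewrite !Arg3; have [ai|ai] := eqVneq a i; have [ai'|ai'] := eqVneq a' i => //.
  + have ia' : i < a' by lia.
    have [h1 h2] := hiS _ san ia'.
    have := mono i.+1 a' san _ (odd2 _ a'P ai') ia'; rewrite ei2 -mS => /(_ isT); lia.
  + have ai1 : a <= i.-1 by lia.
    have := mono a i.-1 _ (odd2 _ aP ai) _ ai1; rewrite ei1 -/lo.
    by move=> H; apply: leq_trans lox; apply: H => //; lia.
  by apply: mono => //; apply: odd2.
- by lia.
move=> sn; rewrite Arg3 ifF; last lia.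
have [h1 _] := hiS i.+2 sn (leqnSn _); rewrite mS in h1; lia.
Qed.

(** Once [i] exceeds the index of every column of this stride, the bound excludes nothing. *)
Lemma filled_bound s i i' st : 0 < s -> (n < s * i) || (n < i) ->
  filled s i st -> filled s i' st.
Proof.
move=> s0 si [ok mono].
have small a : s * a <= n -> a < i.
  move=> san; rewrite -(ltn_pmul2l s0).
  by case/orP: si => [|ni]; [lia|have := leq_pmull a s0; nia].
split=> [a san _|a a' san _ _ aa']; first by apply: ok => //; rewrite small ?orbT.
apply: mono => //; apply/orP; right; apply: small => //.
by apply: leq_trans san; rewrite leq_mul2l aa' orbT.
Qed.

(** The even multiples of [s] are the multiples of [s.*2], and the only index below 1 is even. *)
Lemma filled_halve s st : 0 < s -> filled s.*2 n.+1 st -> filled s 1 st.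
Proof.
move=> s0 [ok mono].
have even a : ~~ odd a || (a < 1) -> s * a = s.*2 * a./2.
  by move=> ea; rewrite -doubleMl doubleMr; congr (_ * _); lia.
have small a : s.*2 * a <= n -> ~~ odd a || (a < n.+1).
  by move=> san; rewrite orbC ltnS; have := @leq_pmull a s.*2; lia.
split=> [a san /even E|a a' san /even E /even E' aa'].
  by rewrite E in san *; apply: ok (small _ _).
rewrite E E' in san *; have cc' : a./2 <= a'./2 by apply: half_leq.
apply: mono => //; apply: small => //.
by apply: leq_trans san; rewrite leq_mul2l cc' orbT.
Qed.

Lemma run_refine b st s (Q : nat -> store -> Prop) : 0 < s ->
  in_layer st -> st Step 0 = s.*2 -> filled s.*2 n.+1 st ->
  (forall b' st', in_layer st' -> st' Step 0 = s -> filled s n.+1 st' -> b <= b' -> Q b' st') ->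
  run refine (b + (25 * n.+1 + 3)) st Q.
Proof.
move=> s0 [FR old] Ss /filled_halve fl HQ.
have -> : b + (25 * n.+1 + 3) = (b + 25 * n.+1 + 1).+2 by lia.
do 2![apply: run_seq; apply: run_assign => //=]; rewrite Ss doubleK.
(* A column costs 18 beyond its drop in potential and advances [s * i]; the drops amount to at most
   [7 * n]. *)
pose Inv b' st' := exists i, [/\ odd i, in_layer st', st' Step 0 = s /\ st' M 0 = s * i,
  filled s i st' & b < b' /\
    (s * i <= n -> b + 18 * (n.+1 - s * i) + 7 * (n - st' Arg (row + s * i.-1)) < b')].
apply: (@run_loop _ _ _ Inv).
  exists 1; split=> //=; [|by rewrite muln1|exact: fl|lia].
  by split=> //; move=> a k; have := FR a k; case: a.
move=> b' st' [i [oi il [Si Mi] fi [bb' budget]]].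
rewrite /= Mi [n + 1]addn1 ltnS; case: leqP => /= [sin|nsi]; last first.
  exists b; first lia; apply: HQ => //; apply: filled_bound fi => //.
  by rewrite nsi.
exists (b + 18 * (n - s * i) + 1 + 7 * (n - st' Arg (row + s * i.-1)) + 17).
  by have := budget sin; lia.
apply: (run_column s0 oi) => // b2 st2 il2 S2 M2 fi2 b2b budget2.
exists i.+2; split=> //; first by rewrite /= negbK.
split=> [|s2n]; first lia.
by have := budget2 s2n; rewrite !mulnS in s2n *; lia.
Qed.

Lemma run_stride b st r (Q : nat -> store -> Prop) :
  in_layer st -> st Step 0 = 2 ^ r -> filled (2 ^ r) n.+1 st ->
  (forall b' st', in_layer st' -> filled 1 n.+1 st' -> b <= b' -> Q b' st') ->
  run (loop (Lt (Const 1) (reg Step)) refine) (b + r * (25 * n.+1 + 4) + 1) st Q.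
Proof.
move=> il Sr fl HQ.
pose Inv b' st' := exists r', [/\ in_layer st', st' Step 0 = 2 ^ r',
  filled (2 ^ r') n.+1 st' & b + r' * (25 * n.+1 + 4) < b'].
apply: (@run_loop _ _ _ Inv); first by exists r; split=> //; lia.
move=> b' st' [[|r'] [il' Sr' fl' bb']]; rewrite /= Sr'.
  by exists b; [lia|apply: HQ].
have r0 : 0 < 2 ^ r' by rewrite expn_gt0.
rewrite expnS mul2n in Sr' fl' *; rewrite (_ : 1 < _); last lia.
exists (b + r' * (25 * n.+1 + 4) + 1 + (25 * n.+1 + 3)); first lia.
apply: run_refine r0 il' Sr' fl' _ => b2 st2 il2 S2 f2 b2b.
by exists r'; split=> //; lia.
Qed.
End Layer.

(** * The rows of all rounds *)

Definition cost_of (st : store) l m := st Cost (l * n.+1 + m).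
(** The argmins pointing into row [l] are stored with row [l.+1], hence the shift. *)
Definition arg_of (st : store) l m := st Arg (l.+1 * n.+1 + m).

Definition rows l (st : store) :=
  (forall m, m <= n -> cost_of st 0 m = gap t 0 m) /\
  forall l', l' < l -> dp_row t (cost_of st) (arg_of st) l'.

Lemma best_ext e e' m x : (forall j, j <= m -> e' j = e j) -> best t e m x -> best t e' m x.
Proof. by move=> ee' [xm H]; split=> // j jm; rewrite !ee' //; apply: H. Qed.

(** Rows 0 to [l] lie entirely below the offset [l.+1 * n.+1]. *)
Lemma rows_frame l st st' : rows l st ->
  (forall k, k < l.+1 * n.+1 -> st' Arg k = st Arg k /\ st' Cost k = st Cost k) ->
  rows l st'.
Proof.
move=> [r0 rS] agree.
have agree' l' m : l' <= l -> m <= n -> st' Arg (l' * n.+1 + m) = st Arg (l' * n.+1 + m) /\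
    st' Cost (l' * n.+1 + m) = st Cost (l' * n.+1 + m).
  by move=> ll' mn; apply: agree; nia.
split=> [m mn|l' ll' m mn]; first by rewrite -r0 // /cost_of (agree' 0 m _ mn).2.
have [bst E] := rS l' ll' m mn.
rewrite /arg_of (agree' l'.+1 m ll' mn).1 -/(arg_of st l' m).
have le_n := leq_trans bst.1 mn.
split; last first.
  by rewrite /cost_of (agree' l'.+1 m ll' mn).2 (agree' l' _ (ltnW ll') le_n).2.
apply: best_ext bst => j jm.
by rewrite /cost_of (agree' l' j (ltnW ll') (leq_trans jm mn)).2.
Qed.

Definition layer_frame := [:: Prev; Row; L] ++ layer_slots.

Lemma run_layer b st l r (Q : nat -> store -> Prop) : n < 2 ^ r ->
  tables st -> (forall m, m <= n -> st Head m = gap t 0 m) -> st Pow 0 = 2 ^ r ->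
  st L 0 = l -> st Row 0 = l * n.+1 -> rows l st ->
  (forall b' st', frame layer_frame st st' -> st' L 0 = l.+1 ->
     st' Row 0 = l.+1 * n.+1 -> rows l.+1 st' -> b <= b' -> Q b' st') ->
  run layer (b + r * (25 * n.+1 + 4) + 7) st Q.
Proof.
move=> nr Tab Hd Pr Ll Rr rws HQ.
have -> : b + r * (25 * n.+1 + 4) + 7 = (b.+1 + r * (25 * n.+1 + 4) + 1).+4.+1 by lia.
pose st0 := set_slot (set_slot st Prev 0 (l * n.+1)) Row 0 (l.+1 * n.+1).
do 2![apply: run_seq; apply: run_assign => //=]; rewrite Rr.
rewrite (_ : l * n.+1 + (n + 1) = l.+1 * n.+1); last by rewrite mulSn; lia.
rewrite -/st0; do 3![apply: run_seq; apply: run_assign => //=]; rewrite (Pr : st0 Pow 0 = _).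
set row := l.+1 * n.+1; set st1 := set_slot _ Step _ _.
have row_prev : st0 Row 0 = st0 Prev 0 + n.+1 by rewrite /st0 /= mulSn addnC.
have il1 : in_layer st0 st1.
  split=> [|k kr]; first by move=> a k; case: a.
  by rewrite /st1 /st0 /= -/row ltn_eqF.
(* As [2 ^ r] exceeds [n], the coarsest stride demands column 0 only. *)
have fl1 : filled st0 (2 ^ r) n.+1 st1.
  have a0 a : 2 ^ r * a <= n -> a = 0 by case: a => // a; rewrite mulnS; lia.
  split=> [a /a0-> _|a a' /a0-> _ _ ]; last by rewrite leqn0 => /eqP->.
  rewrite muln0; split.
    by rewrite /st1 /st0 /= -/row addn0 eqxx; split=> // j; rewrite leqn0 => /eqP->.
  by rewrite /st1 /st0 /= -/row addn0 eqxx /gap big_geq // !addn0.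
apply: run_seq; apply: (@run_stride st0 Tab Hd row_prev b.+1 st1 r) => //.
move=> b2 st2 [FR2 old2] [ok _] bb2.
apply: (@run_le _ _ _ b2.-1.+1); first lia.
apply: run_assign => //; rewrite [value _ _ _ _]/=; set st3 := set_slot _ L _ _.
have L2 : st2 L 0 = l by rewrite (FR2 L).
have R2 : st2 Row 0 = row by rewrite (FR2 Row).
have rws3 : rows l st3.
  by apply: rows_frame rws _ => k kr; rewrite /st3 /=; apply: old2.
apply: HQ.
- by move=> a k; have := FR2 a k; case: a.
- by rewrite /st3 /= L2 addn1.
- by rewrite /st3 /= R2.
- split=> [|l']; first exact: rws3.1.
  rewrite ltnS leq_eqVlt => /predU1P[->|]; last exact: rws3.2.
  move=> m mn; have [] := ok m; rewrite ?mul1n //.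
    by rewrite ltnS mn orbT.
  move=> bst E; have old_row j : j <= n -> cost_of st3 l j = st Cost (l * n.+1 + j).
    move=> jn; have kr : l * n.+1 + j < row by rewrite /row mulSn; lia.
    by rewrite /cost_of /st3 /= (old2 _ kr).2.
  split; first by apply: best_ext bst => j jm; apply: old_row; lia.
  by rewrite old_row; [exact: E|exact: leq_trans bst.1 mn].
lia.
Qed.

Lemma run_layers b st r (Q : nat -> store -> Prop) : n < 2 ^ r ->
  tables st -> st Pow 0 = 2 ^ r ->
  (forall m, m <= n -> st Head m = gap t 0 m /\ st Cost m = gap t 0 m) ->
  (forall b' st', frame layer_frame st st' -> st' L 0 = lam ->
     st' Row 0 = lam * n.+1 -> rows lam st' -> b <= b' -> Q b' st') ->
  run layers (b + lam * (r * (25 * n.+1 + 4) + 8) + 3) st Q.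
Proof.
move=> nr Tab Pr Hd HQ.
have -> : b + lam * (r * (25 * n.+1 + 4) + 8) + 3 =
  (b + lam * (r * (25 * n.+1 + 4) + 8) + 1).+2 by lia.
do 2![apply: run_seq; apply: run_assign => //=].
pose Inv b' st' := exists l, [/\ l <= lam, frame layer_frame st st',
  st' L 0 = l /\ st' Row 0 = l * n.+1, rows l st'
  & b + (lam - l) * (r * (25 * n.+1 + 4) + 8) < b'].
apply: (@run_loop _ _ _ Inv).
  exists 0; split=> //=; last by rewrite subn0; lia.
  - by move=> a k; case: a.
  by split=> // m mn; rewrite /cost_of /= (Hd m mn).2.
move=> b' st' [l [ll FR [Ll Rl] rws bb']]; rewrite /= Ll.
case: (ltnP l lam) => /= [llt|lge]; last first.
  have el : l = lam by lia.
  by rewrite el in Ll Rl rws; exists b; [lia|apply: HQ].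
exists (b + (lam - l.+1) * (r * (25 * n.+1 + 4) + 8) + 1 + r * (25 * n.+1 + 4) + 7).
  by rewrite (_ : lam - l = (lam - l.+1).+1) ?mulSn in bb'; lia.
apply: (run_layer nr) Ll Rl rws _ => //.
- exact: tables_frame Tab FR isT.
- by move=> m mn; rewrite (FR Head) // (Hd m mn).1.
- by rewrite (FR Pow).
move=> b2 st2 FR2 L2 R2 rws2 bb2; exists l.+1; split=> //; last lia.
by move=> a k aP; rewrite (FR2 a k aP) FR.
Qed.

(** * Tracing the chain back and writing the incentive *)

Lemma run_retrace b st s (Q : nat -> store -> Prop) :
  s lam = n -> (forall l, l < lam -> s l = arg_of st l (s l.+1)) ->
  (forall l, l < lam -> s l <= s l.+1) ->
  st L 0 = lam -> st Row 0 = lam * n.+1 -> (forall k, st Sup k = 0) ->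
  (forall b' st', frame [:: K; L; Row; M; Idx; Sup] st st' ->
     (forall r, r < s 0 -> st' Sup r = 0) ->
     (forall l r, l < lam -> s l <= r < s l.+1 -> st' Sup r = s l) -> b <= b' -> Q b' st') ->
  run retrace (b + 7 * lam + 3 * n + 2) st Q.
Proof.
move=> sn so smono Ll Rr S0 HQ.
have -> : b + 7 * lam + 3 * n + 2 = (b + 7 * lam + 3 * n + 1).+1 by lia.
apply: run_seq; apply: run_assign => //=.
pose FS := [:: K; L; Row; M; Idx; Sup].
(* Rounds from [l] on are recorded while [Sup] is still zero below [s l]; the filling costs
   telescope to at most [3 * n]. *)
pose Inv b' st' := exists l, [/\ l <= lam, frame FS st st',
  [/\ st' L 0 = l, st' Row 0 = l * n.+1 & st' K 0 = s l],
  (forall r, r < s l -> st' Sup r = 0) /\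
  (forall l' r, l <= l' < lam -> s l' <= r < s l'.+1 -> st' Sup r = s l')
  & b + 7 * l + 3 * s l < b'].
apply: (@run_loop _ _ _ Inv).
  exists lam; split=> //=; [|by split=> // *; lia|by rewrite sn; lia].
  by move=> a k; case: a.
move=> b' st' [l [ll FR [Ll' Rl Kl] [Slow Shigh] bb']]; rewrite /= Ll'.
case: l => [|l] /= in ll Ll' Rl Kl Slow Shigh bb' *.
  by exists b; [lia|apply: HQ => // l r llam; apply: Shigh].
have sl : s l <= s l.+1 by apply: smono.
exists (b + 7 * l + 3 * s l.+1 + 5).+2; first lia.
do 2![apply: run_seq; apply: run_assign => //=].
rewrite Rl Kl (FR Arg) // -/(arg_of st l (s l.+1)) -so //.
apply: run_seq.
pose Inv2 b2 st2 := exists i, [/\ s l <= i <= s l.+1, frame FS st st',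
  [/\ st2 Idx 0 = i, st2 M 0 = s l, st2 K 0 = s l.+1, st2 L 0 = l.+1 & st2 Row 0 = l.+1 * n.+1],
  frame FS st st2 /\
  (forall r, st2 Sup r = if s l <= r < i then s l else st' Sup r)
  & b + 7 * l + 3 * s l + 3 * (s l.+1 - i) + 5 <= b2].
apply: (@run_loop _ _ _ Inv2).
  exists (s l); split=> //=; [lia|split=> //|lia].
    by move=> a k; have := FR a k; case: a.
  by move=> r; rewrite ifF //; lia.
move=> b2 st2 [i [ib _ [Ii Mm Kk L2 R2] [FR2 S2] bb2]].
rewrite /= Ii Kk; case: (ltnP i (s l.+1)) => /= [isl|sli]; last first.
  exists (b + 7 * l + 3 * s l).+4; first lia.
  do 2![apply: run_seq; apply: run_assign => //=]; apply: run_assign => //=.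
  have ei : i = s l.+1 by lia.
  exists l; split=> //; first exact: ltnW.
  - by move=> a k; have := FR2 a k; case: a.
  - by split=> //=; rewrite ?L2 ?R2 ?Mm // ?mulSn; lia.
  - split=> [r rl|l' r /andP[ll' l'lam] rl'] /=; rewrite S2.
      by rewrite ifF ?Slow //; lia.
    move: ll'; rewrite leq_eqVlt => /predU1P[el|ll'].
      by rewrite -el in rl' *; rewrite ei rl'.
    have sll' : s l.+1 <= s l' by apply: (chain_mono smono) => //; apply: ltnW.
    by rewrite ifF; [apply: Shigh; rewrite ?ll'|lia].
exists (b + 7 * l + 3 * s l + 3 * (s l.+1 - i.+1) + 5).+2; first lia.
apply: run_seq; do 2![apply: run_assign => //=].
exists i.+1; split=> //=; first lia.
- by split=> //=; rewrite Ii addn1.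
split=> [|r]; first by move=> a k; have := FR2 a k; case: a.
by rewrite Ii Mm S2; case: eqP => [->|ri]; [rewrite ifT|congr (if _ then _ else _)]; lia.
Qed.

Lemma run_emit b st (Q : nat -> store -> Prop) :
  (forall k, k <= n -> st Below k = below t k) ->
  (forall b' (st' : store), (forall v : 'I_n, st' Out v = t v - st Sup (rank t v)) ->
     b <= b' -> Q b' st') ->
  run emit (b + 6 * n + 2) st Q.
Proof.
move=> Bel HQ; apply: run_seq; rewrite addn2; apply: run_assign => //=.
have tt_n i : i < n -> tt i <= n.
  by move=> il; have := t_range (Ordinal il); rewrite -tt_t /=; lia.
pose Inv b' st' := exists i, [/\ i <= n, st' Idx 0 = i, b + 6 * (n - i) < b',
  forall k, st' Sup k = st Sup k
  & (forall k, k <= n -> st' Below k = below t k + \sum_(0 <= u < i) (tt u == k)) /\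
    (forall v : 'I_n, v < i -> st' Out v = t v - st Sup (rank t v))].
apply: (@run_loop _ _ _ Inv).
  exists 0; split=> //=; first lia.
  by split=> // k kn; rewrite big_geq // addn0 Bel.
move=> b' st' [i [il Ii bb' SS [B' O']]]; rewrite /= Ii.
case: (ltnP i n) => /= [lin|nin]; last first.
  by exists b; [lia|apply: HQ => // v; apply: O' (leq_trans (ltn_ord v) nin)].
exists (b + 6 * (n - i.+1)).+1.+4.+1; first lia.
apply: run_seq; apply: run_read; rewrite //= ?Ii //.
do 3![apply: run_seq; apply: run_assign => //=]; first by rewrite Ii.
apply: run_assign => //=; exists i.+1; split=> //=; first by rewrite Ii addn1.
pose w := Ordinal lin.
(* The increments made so far to this cell count the earlier nodes of equal threshold, the second
   summand of [rank]. *)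
have rk : st' Below (tt i) = rank t w.
  rewrite B' ?tt_n // /rank -(tt_t w) /=; congr (_ + _).
  rewrite (big_nat_widen _ _ n) ?(ltnW lin) // big_mkord big_mkcond /=.
  by apply: eq_bigr => u _; rewrite -!tt_t /=; case: (_ < _).
split=> [k kn|v].
  rewrite big_nat_recr //= addnA -B' // [tt i == k]eq_sym.
  by case: eqP => [->|_]; rewrite ?addn0.
rewrite ltnS leq_eqVlt Ii => /predU1P[vi|vi].
  have -> : v = w by apply: val_inj.
  by rewrite eqxx -rk SS (tt_t w).
by rewrite (ltn_eqF vi) O'.
Qed.

(** * Optimality and total time *)

Lemma TBI_optimal_ext N p p' : p' =1 p -> TBI_optimal N t lam p -> TBI_optimal N t lam p'.
Proof.
move=> pp' [[inc all] opt].
have inf l : influenced N t p' l = influenced N t p l.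
  by elim: l => [|l /= ->]; apply/setP => v; rewrite !inE pp'.
split; first by split=> [v|]; rewrite ?inf // pp'.
move=> q /opt; apply: leq_trans; rewrite /incentive_cost.
by under eq_bigr do rewrite pp'.
Qed.

Lemma rows_chain l (st : store) : rows l st ->
  exists s, [/\ s l = n, forall i, i < l -> s i = arg_of st i (s i.+1),
    forall i, i < l -> s i <= s i.+1 & forall s', (forall i, i < l -> s' i <= s' i.+1) ->
      s' l = n -> chain_cost t l s <= chain_cost t l s'].
Proof.
(* [back d] is the chain element [d] rounds before the end, found by following argmins from [n]. *)
move=> [r0 rS]; pose back := fix back d := if d is d'.+1 then arg_of st (l - d) (back d') else n.
pose s i := back (l - i).
have sl : s l = n by rewrite /s subnn.
have so i : i < l -> s i = arg_of st i (s i.+1).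
  by move=> il; rewrite /s -(subnSK il) /= subnSK // subKn // ltnW.
have [||||mono E] := @dp_attained _ t (cost_of st) (arg_of st) l s => //; first by rewrite sl.
exists s; split=> // s' mono' s'l.
rewrite -E sl.
by have := @dp_lower _ t (cost_of st) (arg_of st) l s' r0 rS mono'; rewrite s'l; apply.
Qed.

Definition empty_store : store := fun _ _ => 0.

Lemma run_program (Q : nat -> store -> Prop) : 1 < n -> 0 < lam ->
  (forall b' (st' : store), TBI_optimal (@complete_nbhd n) t lam (fun v => st' Out v) ->
     Q b' st') ->
  run program (400 * (lam * n * trunc_log 2 n)) empty_store Q.
Proof.
move=> n1 lam0 HQ; set l := trunc_log 2 n.
have l0 : 0 < l by rewrite trunc_log_gt0.
pose blayers r := lam * (r * (25 * n.+1 + 4) + 8).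
(* Since [n] is at least 2, the logarithm is positive and all lower-order terms are absorbed by
   [lam * n * l]. *)
have total : 0 + 6 * n + 2 + 7 * lam + 3 * n + 2 + blayers l.+1 + 3 + 2 * l.+1 + 2 +
    8 * n + 8 + 5 * (n + n + 1) + 2 + 4 * n + 2 < 400 * (lam * n * l).
  have T1 : n <= lam * n * l by rewrite mulnAC leq_pmull // muln_gt0 lam0.
  have T2 : lam <= lam * n * l by rewrite -mulnA leq_pmulr // muln_gt0 l0; lia.
  have T3 : l <= lam * n * l by rewrite leq_pmull // muln_gt0 lam0; lia.
  have T4 : l.+1 * (25 * n.+1 + 4) + 8 <= 2 * l * (40 * n) + 4 * (n * l).
    by apply: leq_add; [apply: leq_mul|have := leq_pmulr n l0]; lia.
  have T5 : blayers l.+1 <= 84 * (lam * n * l).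
    by rewrite /blayers; apply: leq_trans (leq_mul (leqnn lam) T4) _; lia.
  lia.
apply: run_le total _; apply: (run_cond (B := true)) => // [|_].
  by rewrite /=; lia.
apply: run_seq; apply: run_count => // st1 FR1 Cnt.
apply: run_seq; apply: run_tabulate; rewrite ?FR1 // => st2 FR2 Tab2.
apply: run_seq; apply: run_init_row => // st3 FR3 Hd3.
have Tab3 := tables_frame Tab2 FR3 isT.
apply: run_seq; apply: run_init_stride; first lia.
move=> st4 r FR4 P4 nr rl.
have Tab4 := tables_frame Tab3 FR4 isT.
(* The actual exponent [r] is at most [l.+1], for which the time was budgeted. *)
apply: run_seq; apply: (run_le (b' := 0 + 6 * n + 2 + 7 * lam + 3 * n + 2 + blayers r + 3)).
  have : blayers r <= blayers l.+1 by rewrite /blayers leq_mul2l leq_add2r leq_mul2r rl !orbT.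
  lia.
apply: (run_layers nr Tab4 P4) => [m mn|b5 st5 FR5 L5 R5 rws b5b].
  by rewrite !FR4 //; apply: Hd3.
have [s [sn so smono s_opt]] := rows_chain rws.
apply: run_seq; apply: (run_le b5b); apply: (run_retrace sn so smono L5 R5).
  by move=> k; rewrite FR5 // FR4 // FR3 // FR2 // FR1.
move=> b6 st6 FR6 sup0 supS b6b.
have Bel k : k <= n -> st6 Below k = below t k.
  move=> kn; rewrite FR6 // FR5 //; have [//|->//] := Tab4 k _; lia.
apply: (run_le b6b); apply: (run_emit Bel) => b7 st7 Out7 _; apply: HQ.
have tn v : t v <= n by have := t_range v; lia.
apply: (TBI_optimal_ext Out7).
split=> [|q /(feasible_lower tn)[s' [mono' s'n cost']]].
  exact: chain_feasible smono sn sup0 supS.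
(* The output costs at most the optimal chain, hence at most the chain of set sizes of [q]. *)
apply: leq_trans (chain_cost_upper smono sn supS tn) _.
by apply: leq_trans (s_opt _ mono' s'n) cost'.
Qed.
End Correctness.

Theorem theorem3 :
  exists (P : cmd) (c : nat),
    forall (n : nat) (t : 'I_n -> nat) (lam : nat),
      (forall v : 'I_n, 1 <= t v <= n.-1) -> 1 <= lam ->
      exists (k : nat) (m' : memory),
        [/\ exec P (@tbi_input n lam t) k m',
            k <= c * (lam * n * trunc_log 2 n) + c
          & TBI_optimal (@complete_nbhd n) t lam (@tbi_output n m')].
Proof.
exists program, 400 => n t lam t_range lam0.
pose tt := nth 0 [seq t i | i <- enum 'I_n].
have size_t : size [seq t i | i <- enum 'I_n] = n by rewrite size_map size_enum_ord.
have tt_t (v : 'I_n) : tt v = t v.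
  by rewrite /tt (nth_map v) ?size_enum_ord // nth_ord_enum.
have init : represents n lam tt (tbi_input lam t) empty_store.
  (* Lookups past the thresholds return the default 0, so output and scratch cells start empty. *)
  have tail a : n <= a -> nth 0 [seq t i | i <- enum 'I_n] a = 0.
    by move=> na; rewrite nth_default // size_t.
  split=> //= [i il|i il|a k apos]; rewrite /tbi_input /=.
  - by rewrite addKn.
  - by rewrite tail //; lia.
  - by rewrite !ifF ?tail //; lia.
have [n0|n0] := posnP n.
  subst n; exists 2, (tbi_input lam t); split=> //; [by apply: ExIfF; constructor|lia|].
  split=> [|q _]; last by rewrite /incentive_cost big_ord0.
  by split=> [[]//|]; apply/setP => -[].
(* A single node would need a threshold between 1 and 0. *)
have n1 : 1 < n by have := t_range (Ordinal n0); lia.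
have [|k [m' [b' [st' [ex [_ _ _ out _] kb opt]]]]] :=
  @run_program n lam t tt tt_t t_range
    (fun _ st => TBI_optimal (@complete_nbhd n) t lam (fun v => st Out v)) n1 lam0 _ _ init.
  by [].
exists k, m'; split=> //; first lia.
by apply: TBI_optimal_ext opt => v; apply: out.
Qed.
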